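(* Let $n,m\ge1$, let $\mu\in\mathbb{R}^n_{\ge0}$, $\nu\in\mathbb{R}^m_{\ge0}$ be probability vectors, let $D_X\in\mathbb{R}^{n\times n}$, $D_Y\in\mathbb{R}^{m\times m}$ be symmetric, let $C_1=\{\pi\ge0:\pi\mathbf{1}_m=\mu\}$, $C_2=\{\pi\ge0:\pi^T\mathbf{1}_n=\nu\}$ in $\mathbb{R}^{n\times m}$, let $f(\pi,w)=-\mathrm{Tr}(D_X\pi D_Yw^T)$, and let $\rho>0$. Take $h(x)=\tfrac12\|x\|^2$, so $D_h(x,y)=\tfrac12\|x-y\|^2$, and define $$F_\rho(\pi,w)=f(\pi,w)+\mathbb{I}_{C_1}(\pi)+\mathbb{I}_{C_2}(w)+\tfrac{\rho}{2}\|\pi-w\|^2.$$ Let $\{(\pi^k,w^k)\}_{k\ge0}$ be generated from an initial point by $$\pi^{k+1}=\arg\min_{\pi\in C_1}\{f(\pi,w^k)+\tfrac{\rho}{2}\|\pi-w^k\|^2\},\qquad w^{k+1}=\arg\min_{w\in C_2}\{f(\pi^{k+1},w)+\tfrac{\rho}{2}\|w-\pi^{k+1}\|^2\}.$$ Then the sequence $\{(\pi^k,w^k)\}$ converges to a critical point of $F_\rho$, i.e. to a point $(\bar\pi,\bar w)$ with $0\in\partial F_\rho(\bar\pi,\bar w)$.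
   Context: $\|\cdot\|$ is the Frobenius norm; $\pi\ge0$ is entrywise; $\mathbb{I}_C$ is the indicator function of $C$ ($0$ on $C$, $+\infty$ outside); $\partial F_\rho$ denotes the (limiting) subdifferential, which here equals $\nabla f(\pi,w)+\rho(\pi-w,\,w-\pi)+\mathcal{N}_{C_1}(\pi)\times\mathcal{N}_{C_2}(w)$ for $\pi\in C_1,w\in C_2$, with $\mathcal{N}_C$ the normal cone. *)

(* Defs.v *)
From HB Require Import structures.
From mathcomp Require Import all_boot all_order all_algebra.
From mathcomp Require Import all_classical all_reals all_analysis.
Set Implicit Arguments. Unset Strict Implicit. Unset Printing Implicit Defensive.
Import Order.TTheory GRing.Theory Num.Theory.
Local Open Scope ring_scope.

Definition frob {R : realType} {n m : nat} (A B : 'M[R]_(n, m)) : R :=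
  \sum_(i < n) \sum_(j < m) A i j * B i j.
Definition frob_sq {R : realType} {n m : nat} (A : 'M[R]_(n, m)) : R := frob A A.

Definition prob_vec {R : realType} {n : nat} (p : 'cV[R]_n) : Prop :=
  (forall i, 0 <= p i 0) /\ \sum_(i < n) p i 0 = 1.

Definition C1 {R : realType} {n m : nat} (mu : 'cV[R]_n) (pi : 'M[R]_(n, m)) : Prop :=
  (forall i j, 0 <= pi i j) /\ pi *m const_mx 1 = mu.
Definition C2 {R : realType} {n m : nat} (nu : 'cV[R]_m) (w : 'M[R]_(n, m)) : Prop :=
  (forall i j, 0 <= w i j) /\ w^T *m const_mx 1 = nu.

Definition gw_f {R : realType} {n m : nat} (DX : 'M[R]_n) (DY : 'M[R]_m)
  (pi w : 'M[R]_(n, m)) : R := - \tr (DX *m pi *m DY *m w^T).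

(* Partial gradients of f (f is bilinear: f(pi,w) = -<D_X pi D_Y, w>
   = -<pi, D_X^T w D_Y^T>). *)
Definition grad_pi_f {R : realType} {n m : nat} (DX : 'M[R]_n) (DY : 'M[R]_m)
  (pi w : 'M[R]_(n, m)) : 'M[R]_(n, m) := - (DX^T *m w *m DY^T).
Definition grad_w_f {R : realType} {n m : nat} (DX : 'M[R]_n) (DY : 'M[R]_m)
  (pi w : 'M[R]_(n, m)) : 'M[R]_(n, m) := - (DX *m pi *m DY).

(* Normal cone of a (convex) set C at x in C:
   N_C(x) = { v | forall y in C, <v, y - x> <= 0 }  (for convex C this is the
   limiting normal cone; empty convention outside C is handled by requiring x \in C). *)
Definition normal_cone {R : realType} {n m : nat} (C : 'M[R]_(n, m) -> Prop)
  (x v : 'M[R]_(n, m)) : Prop :=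
  C x /\ forall y, C y -> frob v (y - x) <= 0.

(* 0 \in dF_rho(pi, w), using
   dF_rho(pi,w) = grad f(pi,w) + rho (pi - w, w - pi) + N_C1(pi) x N_C2(w). *)
Definition critical_point {R : realType} {n m : nat} (DX : 'M[R]_n) (DY : 'M[R]_m)
  (mu : 'cV[R]_n) (nu : 'cV[R]_m) (rho : R) (pi w : 'M[R]_(n, m)) : Prop :=
  normal_cone (C1 mu) pi (- (grad_pi_f DX DY pi w + rho *: (pi - w))) /\
  normal_cone (C2 nu) w (- (grad_w_f DX DY pi w + rho *: (w - pi))).

(* Main.v *)
(* [F_rho] is a quadratic form [a z z / 2] on a product of polytopes. Each half-step minimises a
   strongly convex function, so [F_rho] decreases by at least [rho / 2] times the squared step, and
   the gradient of [F_rho] at an iterate is [O(step)] along the directions of the face containing it.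
   Kurdyka-Lojasiewicz with exponent 1/2 then needs linear algebra only: if [z] and [z'] have the
   same zero entries, [d = z - z'] is a face direction and
   [F_rho z - F_rho z' = a d d / 2 + a z' d], where [a d d] is a quadratic function of the linear
   form [a d] on the face directions, hence is bounded by the squares of the two steps. As there
   are finitely many faces, the gap to the limit value is [O(step^2)], which makes the steps
   summable; the optimality conditions of the half-steps pass to the limit. *)
Require Import Defs.
From HB Require Import structures.
From mathcomp Require Import all_boot all_order all_algebra.
From mathcomp Require Import all_classical all_reals all_analysis.
From mathcomp Require Import ring lra.
Import numFieldNormedType.Exports.
Import Order.TTheory GRing.Theory Num.Theory.
Local Open Scope classical_set_scope.
Local Open Scope ring_scope.

(** * Subspaces and quadratic forms on them *)

(** A subspace of maximal dimension inside [P] is all of [P]: adjoining the line of any [v]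
    satisfying [P] stays in [P], so it cannot raise the dimension. *)
Lemma subspace_vspace {K : fieldType} {V : vectType K} (P : V -> Prop) :
  P 0 -> (forall c u v, P u -> P v -> P (c *: u + v)) ->
  exists U : {vspace V}, forall v, v \in U <-> P v.
Proof.
move=> P0 Plin.
pose D k := `[< exists U : {vspace V}, \dim U = k /\ forall v, v \in U -> P v >].
have D0 : exists k, D k.
  exists 0%N; apply/asboolP; exists 0%VS; split; first exact: dimv0.
  by move=> v; rewrite memv0 => /eqP->.
have Dle k : D k -> (k <= \dim {:V})%N.
  by move/asboolP => [U [<- _]]; exact/dimvS/subvf.
case: (ex_maxnP D0 Dle) => k /asboolP[U [dimU UP]] kmax.
exists U => v; split=> [|Pv]; first exact: UP.
have : (\dim (U + <[v]>) <= k)%N.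
  apply/kmax/asboolP; exists (U + <[v]>)%VS; split => // z /memv_addP[u uU [w]].
  by move=> /vlineP[c ->] ->; rewrite addrC; apply: Plin => //; exact: UP.
rewrite -dimU => dimUv; have := addvSl U <[v]>.
rewrite (geq_leqif (dimv_leqif_sup (addvSl U <[v]>))) in dimUv => _.
by apply: (subvP dimUv); rewrite -{1}[v]add0r memv_add ?mem0v ?memv_line.
Qed.

Lemma symmetric_mx_pinv {K : fieldType} {n : nat} (S : 'M[K]_n) (x : 'rV[K]_n) :
  S^T = S -> x *m S *m x^T = x *m S *m pinvmx S *m (x *m S)^T.
Proof.
move=> symS; have := mulmxKpV (submx_refl S); move: (pinvmx S) => G SGS.
by rewrite trmx_mul symS -{1}SGS !mulmxA.
Qed.

(* On [T], the form [a] has a Gram matrix [S], and [x S x^T = (x S) S^+ (x S)^T]: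
   [a d d] is a quadratic function of the linear form [a d], even when [a] is degenerate. *)
Lemma quadratic_le_dual {R : realType} {V : vectType R} (a : V -> V -> R)
    (aC : forall x y, a x y = a y x)
    (alin : forall x c y z, a x (c *: y + z) = c * a x y + a x z)
    (T : {vspace V}) (N : V -> R) :
  exists2 C : R, 0 <= C & forall (d : V) (e : R), d \in T -> 0 <= e ->
    (forall t, t \in T -> `|a d t| <= e * N t) -> `|a d d| <= C * e ^+ 2.
Proof.
pose b := vbasis T; pose S : 'M[R]_(\dim T) := \matrix_(i, j) a b`_i b`_j.
have symS : S^T = S by apply/matrixP => i j; rewrite !mxE aC.
have a0 x : a x 0 = 0 by have := alin x 1 0 0; rewrite scaler0 addr0 mul1r; lra.
have asum x (I : finType) (c : I -> R) (v : I -> V) :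
    a x (\sum_i c i *: v i) = \sum_i c i * a x (v i).
  apply: (big_ind2 (fun u r => a x u = r)) => // [u _ w _ <- <-|i _].
    by rewrite -[u in a x (u + _)]scale1r alin mul1r.
  by rewrite -[c i *: _]addr0 alin a0 addr0.
(* The constant bounds [S^+] as a quadratic form in the values [a d b_i]; the absolute values are
   there because [N] carries no sign assumption. *)
exists (\sum_(i < \dim T) \sum_(j < \dim T) `|N b`_i| * `|pinvmx S i j| * `|N b`_j|).
  by do 2!(apply: sumr_ge0 => ? _); rewrite !mulr_ge0.
move=> d e dT e0 dle; pose x : 'rV[R]_(\dim T) := \row_i coord b i d.
have dE : d = \sum_(i < \dim T) x 0 i *: b`_i.
  by rewrite [LHS](coord_vbasis dT); apply: eq_bigr => i _; rewrite mxE.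
have xSE (j : 'I_(\dim T)) : (x *m S) 0 j = a d b`_j.
  rewrite mxE aC [in RHS]dE asum.
  by apply: eq_bigr => i _; rewrite [S _ _]mxE [a b`_i _]aC.
have -> : a d d = \sum_(i < \dim T) \sum_(j < \dim T) a d b`_i * pinvmx S i j * a d b`_j.
  transitivity ((x *m S *m x^T) 0 0).
    rewrite [X in a d X]dE asum mxE; apply: eq_bigr => i _.
    by rewrite xSE [(_ ^T) _ _]mxE mulrC.
  rewrite symmetric_mx_pinv // mxE exchange_big; apply: eq_bigr => j _.
  rewrite mxE big_distrl; apply: eq_bigr => i _.
  by rewrite [(_ ^T) _ _]mxE !xSE.
rewrite big_distrl (le_trans (ler_norm_sum _ _ _))// ler_sum// => i _.
rewrite big_distrl (le_trans (ler_norm_sum _ _ _))// ler_sum// => j _ /=.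
have bd (k : 'I_(\dim T)) : `|a d b`_k| <= e * `|N b`_k|.
  apply: le_trans (ler_wpM2l e0 (ler_norm _)); apply: dle.
  by apply: vbasis_mem; apply: mem_nth; rewrite size_tuple.
have -> : `|N b`_i| * `|pinvmx S i j| * `|N b`_j| * e ^+ 2 =
  (e * `|N b`_i|) * `|pinvmx S i j| * (e * `|N b`_j|) by ring.
by rewrite !normrM ler_pM ?mulr_ge0// ler_wpM2r.
Qed.

(* Two iterates [z k], [z l] on the same face differ by a direction on which the gradients are small;
   letting [l] go to infinity inside that face gives the gap to the limit value. *)
Lemma quadratic_gap_le {R : realType} {V : vectType R} {J : finType}
    (a : V -> V -> R) (aC : forall x y, a x y = a y x)
    (alin : forall x c y z, a x (c *: y + z) = c * a x y + a x z)
    (z : nat -> V) (face : nat -> J) (T : J -> {vspace V}) (N : V -> R)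
    (delta : nat -> R) (M Fs : R) :
  (forall k, 0 <= delta k) -> delta @ \oo --> (0 : R) ->
  (fun k => a (z k) (z k) / 2 : R) @ \oo --> Fs ->
  (forall k l, face k = face l -> z k - z l \in T (face k)) ->
  (forall k t, t \in T (face k) -> `|a (z k) t| <= delta k * N t) ->
  (forall k l, N (z k - z l) <= M) ->
  exists2 C : R, 0 <= C &
    exists K, forall k, (K <= k)%N -> a (z k) (z k) / 2 - Fs <= C * delta k ^+ 2.
Proof.
move=> d0 dcvg Fcvg zT zN NM; pose F k := a (z k) (z k) / 2.
have /choice[C hC] : forall j, exists C : R, 0 <= C /\
    forall (d : V) (e : R), d \in T j -> 0 <= e ->
    (forall t, t \in T j -> `|a d t| <= e * N t) -> `|a d d| <= C * e ^+ 2.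
  by move=> j; have [C C0 h] := quadratic_le_dual a aC alin (T j) N; exists C.
have gap k l : face k = face l ->
    F k - F l <= C (face k) * (delta k ^+ 2 + delta l ^+ 2) + delta l * `|M|.
  move=> kl; have dT := zT _ _ kl; have [C0 Cle] := hC (face k).
  have aB x y y' : a x (y - y') = a x y - a x y'.
    by rewrite addrC -scaleN1r alin; ring.
  have -> : F k - F l = a (z k - z l) (z k - z l) / 2 + a (z l) (z k - z l).
    rewrite /F !aB ![a (z k - z l) _]aC !aB [a (z l) (z k)]aC; lra.
  have le1 : a (z l) (z k - z l) <= delta l * `|M|.
    apply: (le_trans (ler_norm _)); apply: le_trans (zN _ _ _) _; first by rewrite -kl.
    by apply: ler_wpM2l => //; exact: le_trans (NM _ _) (ler_norm _).
  have : `|a (z k - z l) (z k - z l)| <= C (face k) * (delta k + delta l) ^+ 2.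
    apply: Cle => //; first by rewrite addr_ge0.
    move=> t tT; rewrite aC aB ![a t _]aC mulrDl.
    by rewrite (le_trans (ler_normB _ _))// lerD// zN// -kl.
  have le2 : C (face k) * (delta k + delta l) ^+ 2 <=
      2 * (C (face k) * (delta k ^+ 2 + delta l ^+ 2)).
    rewrite [leRHS]mulrCA; apply: ler_wpM2l => //.
    by have := sqr_ge0 (delta k - delta l); lra.
  by move=> /(le_trans (ler_norm _)); lra.
(* From the index [K j] on, a face that still occurs occurs infinitely often: for a face visited
   finitely often, [K j] lies past its last visit. *)
have /choice[K hK] : forall j, exists K, forall k, (K <= k)%N -> face k = j ->
    forall L, exists2 l, (L <= l)%N & face l = j.
  move=> j; have [h|/existsNP[L hL]] := pselect (forall L, exists2 l, (L <= l)%N & face l = j).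
    by exists 0%N.
  by exists L => k Lk kj; case: hL; exists k.
exists (\sum_j C j); first by apply: sumr_ge0 => j _; have [] := hC j.
exists (\max_j K j)%N => k Kk; pose j := face k.
have -> // : F k - Fs <= C j * delta k ^+ 2 -> F k - Fs <= (\sum_j C j) * delta k ^+ 2.
  move=> /le_trans; apply; apply: ler_wpM2r; first exact: sqr_ge0.
  by rewrite (bigD1 j)//= lerDl sumr_ge0// => i _; have [] := hC i.
apply/ler_addgt0Pr => e e0.
(* [u l] bounds [F k - Fs] for every [l] with the same face as [k], and tends to
   [C j * delta k ^+ 2]; a late [l] on that face always exists. *)
pose u l := C j * (delta k ^+ 2 + delta l ^+ 2) + delta l * `|M| + (F l - Fs).
have ucvg : u @ \oo --> C j * delta k ^+ 2.
  have -> : C j * delta k ^+ 2 = C j * (delta k ^+ 2 + 0 * 0) + 0 * `|M| + (Fs - Fs) by ring.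
  apply: cvgD; last by apply: cvgB => //; exact: cvg_cst.
  apply: cvgD; last by apply: cvgMl.
  by apply: cvgMr; apply: cvgD; [exact: cvg_cst|exact: cvgM].
have [|L _ hL] := @cvgr_lt _ _ \oo _ u _ ucvg (C j * delta k ^+ 2 + e).
  by rewrite ltrDl.
have [l Ll lj] := hK j k (leq_trans (leq_bigmax j) Kk) erefl L.
have := hL l Ll; have := gap k l (esym lj); rewrite /u /= -/j; lra.
Qed.

(** * Convergence from sufficient decrease and a gap bound *)

(** With [s = sqrt (F - Fs)], the steps of [x] are eventually at most [M] times the decrease of [s].
    Hence [x + M * s] is eventually nonincreasing and is bounded below by 0; it converges, as does
    [s], and so does their combination [x]. *)
Lemma descent_cvgn {R : realType} (F x : nat -> R) (Fs c C : R) (K : nat) :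
  0 < c -> 0 <= C -> (forall k, Fs <= F k) -> (forall k, 0 <= x k) ->
  (forall k, (x k.+1 - x k) ^+ 2 <= c * (F k - F k.+1)) ->
  (forall k, (K <= k)%N -> F k.+1 - Fs <= C * (F k - F k.+1)) ->
  cvgn x.
Proof.
move=> c0 C0 FsF x0 xF FC; pose s k := Num.sqrt (F k - Fs).
have s0 k : 0 <= s k by exact: sqrtr_ge0.
have sE k : s k ^+ 2 = F k - Fs by rewrite sqr_sqrtr// subr_ge0.
have Fni k : F k.+1 <= F k.
  by have := le_trans (sqr_ge0 _) (xF k); rewrite pmulr_rge0// subr_ge0.
have sni k : s k.+1 <= s k by rewrite ler_wsqrtr// lerB.
(* The estimate below gives a squared step at most [4 c (1 + C) (p - q)^2]; adding 1 allows
   [M - 1 <= M ^+ 2], which avoids a square root. *)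
pose M := 1 + 4 * c * (1 + C).
have M0 : 1 <= M by rewrite lerDl !mulr_ge0//; lra.
(* The telescoping bound of the Kurdyka-Lojasiewicz argument with exponent 1/2 *)
have xs k : (K <= k)%N -> `|x k.+1 - x k| <= M * (s k - s k.+1).
  move=> Kk; have := FC _ Kk; have := xF k.
  have -> : F k - F k.+1 = s k ^+ 2 - s k.+1 ^+ 2 by rewrite !sE; ring.
  rewrite -sE; move: (s0 k) (s0 k.+1) (sni k).
  move: (s k) (s k.+1) (x k.+1 - x k) => p q d p0 q0 qp dle qle.
  (* From [q^2 <= C (p^2 - q^2)] one gets [p^2 <= (1 + C) (p^2 - q^2) <= 2 (1 + C) p (p - q)]; then
     divide by [p]. *)
  have ple : p <= 2 * (1 + C) * (p - q).
    have [pz|pn0] := eqVneq p 0.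
      by have -> : q = p; [lra|rewrite subrr mulr0 pz].
    have pgt : 0 < p by rewrite lt_def pn0.
    have pq0 : 0 <= (1 + C) * (p - q) ^+ 2 by rewrite mulr_ge0 ?sqr_ge0//; lra.
    by rewrite -(ler_pM2l pgt); lra.
  have Mpq0 : 0 <= M * (p - q) by rewrite mulr_ge0 ?subr_ge0// (le_trans ler01).
  rewrite -ler_sqr ?nnegrE//.
  rewrite real_normK ?num_real// exprMn.
  have le1 : c * (p ^+ 2 - q ^+ 2) <= c * ((p - q) * (2 * p)).
    by apply: ler_wpM2l; [exact: ltW|have := sqr_ge0 (p - q); lra].
  have le2 : c * ((p - q) * (2 * p)) <= c * ((p - q) * (2 * (2 * (1 + C) * (p - q)))).
    by apply: ler_wpM2l; [exact: ltW|apply: ler_wpM2l; lra].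
  have le3 : (M - 1) * (p - q) ^+ 2 <= M ^+ 2 * (p - q) ^+ 2.
    by apply: ler_wpM2r; [exact: sqr_ge0|have := sqr_ge0 (M - 1); move: M0; clear; lra].
  apply: (le_trans dle); apply: (le_trans le1); apply: (le_trans le2).
  apply: le_trans le3; rewrite /M le_eqVlt; apply/orP; left; apply/eqP; ring.
have scvg : cvgn s.
  apply: nonincreasing_is_cvgn; first by apply/nonincreasing_seqP.
  by exists 0 => _ [k _ <-].
have xscvg : cvgn (fun k => x k + M * s k).
  suff /cvg_ex[l lcvg] : cvgn (fun k => x (k + K)%N + M * s (k + K)%N).
    by apply/cvg_ex; exists l; rewrite -(cvg_shiftn K).
  apply: nonincreasing_is_cvgn; last first.
    by exists 0 => _ [k _ <-]; rewrite addr_ge0// mulr_ge0//; lra.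
  apply/nonincreasing_seqP => k; rewrite addSn.
  by have := le_trans (ler_norm _) (xs (k + K)%N (leq_addl _ _)); lra.
have -> : x = (fun k => x k + M * s k) \- (fun k => M * s k).
  by apply/funext => k /=; ring.
have Mscvg : cvgn (fun k => M * s k) by apply: is_cvgMr.
exact: (is_cvgB xscvg Mscvg).
Qed.

(** * Frobenius pairing, entrywise l1 bounds and the bilinear cost *)

Definition l1_norm {R : realType} {n m : nat} (A : 'M[R]_(n, m)) : R :=
  \sum_i \sum_j `|A i j|.

Lemma frob_trE {R : realType} {n m : nat} (A B : 'M[R]_(n, m)) :
  frob A B = \tr (A *m B^T).
Proof. by apply: eq_bigr => i _; rewrite mxE; apply: eq_bigr => j _; rewrite mxE. Qed.

Lemma frobC {R : realType} {n m : nat} (A B : 'M[R]_(n, m)) : frob A B = frob B A.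
Proof. by do 2!(apply: eq_bigr => ? _); rewrite mulrC. Qed.

Lemma frob_linear {R : realType} {n m : nat} (A : 'M[R]_(n, m)) c (B B' : 'M[R]_(n, m)) :
  frob A (c *: B + B') = c * frob A B + frob A B'.
Proof.
rewrite /frob big_distrr -big_split; apply: eq_bigr => i _ /=.
rewrite big_distrr -big_split; apply: eq_bigr => j _ /=.
by rewrite !mxE mulrDr mulrCA.
Qed.

Lemma frobD {R : realType} {n m : nat} (A B B' : 'M[R]_(n, m)) :
  frob A (B + B') = frob A B + frob A B'.
Proof. by rewrite -[B]scale1r frob_linear mul1r scale1r. Qed.

Lemma frob0 {R : realType} {n m : nat} (A : 'M[R]_(n, m)) : frob A 0 = 0.
Proof. by do 2!(apply: big1 => ? _); rewrite mxE mulr0. Qed.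

Lemma frobZ {R : realType} {n m : nat} (A : 'M[R]_(n, m)) c (B : 'M[R]_(n, m)) :
  frob A (c *: B) = c * frob A B.
Proof. by rewrite -[c *: B]addr0 frob_linear frob0 addr0. Qed.

Lemma frobB {R : realType} {n m : nat} (A B B' : 'M[R]_(n, m)) :
  frob A (B - B') = frob A B - frob A B'.
Proof. by rewrite frobD -scaleN1r frobZ mulN1r. Qed.

Lemma frob_sq_ge0 {R : realType} {n m : nat} (A : 'M[R]_(n, m)) : 0 <= frob_sq A.
Proof. by do 2!(apply: sumr_ge0 => ? _); rewrite -expr2 sqr_ge0. Qed.

Lemma sqr_entry_le_frob_sq {R : realType} {n m : nat} (A : 'M[R]_(n, m)) i j :
  A i j ^+ 2 <= frob_sq A.
Proof.
rewrite /frob_sq /frob (bigD1 i)//= (bigD1 j)//= -addrA -expr2 lerDl addr_ge0//.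
  by apply: sumr_ge0 => ? _; rewrite -expr2 sqr_ge0.
by do 2!(apply: sumr_ge0 => ? _); rewrite -expr2 sqr_ge0.
Qed.

Lemma frob_le_l1 {R : realType} {n m : nat} (A B : 'M[R]_(n, m)) e :
  (forall i j, `|B i j| <= e) -> `|frob A B| <= e * l1_norm A.
Proof.
move=> Be; rewrite big_distrr (le_trans (ler_norm_sum _ _ _))// ler_sum// => i _ /=.
rewrite big_distrr (le_trans (ler_norm_sum _ _ _))// ler_sum// => j _ /=.
by rewrite normrM mulrC ler_wpM2r.
Qed.

Lemma l1_norm_ge0 {R : realType} {n m : nat} (A : 'M[R]_(n, m)) : 0 <= l1_norm A.
Proof. by do 2!(apply: sumr_ge0 => ? _). Qed.

Lemma l1_norm_mulmx {R : realType} {n m p : nat} (A : 'M[R]_(n, m)) (B : 'M[R]_(m, p)) :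
  l1_norm (A *m B) <= l1_norm A * l1_norm B.
Proof.
rewrite big_distrl ler_sum// => i _ /=; rewrite big_distrl /=.
apply: (@le_trans _ _ (\sum_k \sum_j `|A i j| * `|B j k|)).
  apply: ler_sum => k _; rewrite mxE (le_trans (ler_norm_sum _ _ _))// ler_sum// => j _.
  by rewrite normrM.
rewrite exchange_big ler_sum// => j _ /=; rewrite -big_distrr ler_wpM2l//=.
by rewrite /l1_norm (bigD1 j)//= lerDl; do 2!(apply: sumr_ge0 => ? _).
Qed.

Lemma l1_norm_le {R : realType} {n m : nat} (A : 'M[R]_(n, m)) :
  (forall i j, `|A i j| <= 1) -> l1_norm A <= (n * m)%:R.
Proof.
move=> A1; apply: (@le_trans _ _ (\sum_(i < n) \sum_(j < m) 1)).
  by do 2!(apply: ler_sum => ? _).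
by rewrite !sumr_const !card_ord -mulrnA mulnC.
Qed.

(** The argument [x] is free because [f] is bilinear: its gradient in one block does not depend on
    that block. The same holds for [gw_f_grad_w]. *)
Lemma gw_f_grad_pi {R : realType} {n m : nat} (DX : 'M[R]_n) (DY : 'M[R]_m)
  (p q x : 'M[R]_(n, m)) : gw_f DX DY p q = frob (grad_pi_f DX DY x q) p.
Proof.
rewrite frob_trE mulNmx raddfN/= -[in RHS]mxtrace_tr !trmx_mul !trmxK.
by rewrite /gw_f !mulmxA [in RHS]mxtrace_mulC !mulmxA.
Qed.

Lemma gw_f_grad_w {R : realType} {n m : nat} (DX : 'M[R]_n) (DY : 'M[R]_m)
  (p q x : 'M[R]_(n, m)) : gw_f DX DY p q = frob (grad_w_f DX DY p x) q.
Proof. by rewrite frob_trE mulNmx raddfN. Qed.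

Lemma gw_f_le {R : realType} {n m : nat} (DX : 'M[R]_n) (DY : 'M[R]_m)
    (p q : 'M[R]_(n, m)) e : 0 <= e -> (forall i j, `|q i j| <= e) ->
  `|gw_f DX DY p q| <= e * (l1_norm DX * l1_norm DY * l1_norm p).
Proof.
move=> e0 qe; rewrite (gw_f_grad_w _ _ _ _ 0) frobC /grad_w_f -scaleN1r frobZ normrM.
rewrite normrN normr1 mul1r frobC (le_trans (frob_le_l1 _ _ _ qe))// ler_wpM2l//.
rewrite mulrAC (le_trans (l1_norm_mulmx _ _))// ler_wpM2r ?l1_norm_ge0//.
exact: l1_norm_mulmx.
Qed.

(** * First-order optimality and faces of polytopes *)

(** A negative slope [L] would dominate the quadratic term for small [s]. *)
Lemma segment_min_ge0 {R : realFieldType} (L K s0 : R) : 0 < s0 ->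
  (forall s, 0 < s -> s <= s0 -> 0 <= s * L + s ^+ 2 * K) -> 0 <= L.
Proof.
move=> s00 h; rewrite leNgt; apply/negP => L0.
(* This [s] makes [s * |K|] at most [- L / 2]; the [+ 1] keeps the denominator positive when
   [K = 0]. *)
pose s := Num.min s0 (- L / (2 * (`|K| + 1))).
have K1 : 0 < 2 * (`|K| + 1) by have := normr_ge0 K; lra.
have spos : 0 < s by rewrite lt_min s00 divr_gt0// oppr_gt0.
have sK : s * (2 * (`|K| + 1)) <= - L by rewrite -ler_pdivlMr// ge_min lexx orbT.
have := h s spos; rewrite ge_min lexx => /(_ isT); apply/negP; rewrite -ltNge.
have -> : s * L + s ^+ 2 * K = s * (L + s * K) by ring.
rewrite pmulr_rlt0//; have := ler_wpM2l (ltW spos) (ler_norm K); lra.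
Qed.

(* [C1 mu] and [C2 nu] are convertible to instances of this predicate. *)
Definition orthant_slice {R : realType} {n m : nat} {U : lmodType R}
  (A : {linear 'M[R]_(n, m) -> U}) (b : U) (x : 'M[R]_(n, m)) : Prop :=
  (forall i j, 0 <= x i j) /\ A x = b.

(** These are the directions of the smallest face containing [x], which is determined by the zero
    entries of [x]. *)
Definition face_dir {R : realType} {n m : nat} {U : lmodType R}
  (A : {linear 'M[R]_(n, m) -> U}) (x t : 'M[R]_(n, m)) : Prop :=
  A t = 0 /\ forall i j, x i j = 0 -> t i j = 0.

(** [x] lies in the relative interior of its face: its zero entries do not move, and its positive
    entries absorb a small change of either sign. *)
Lemma face_dirP {R : realType} {n m : nat} {U : lmodType R}
    (A : {linear 'M[R]_(n, m) -> U}) (b : U) (x t : 'M[R]_(n, m)) :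
  orthant_slice A b x -> face_dir A x t ->
  exists2 s0, 0 < s0 & forall s, `|s| <= s0 -> orthant_slice A b (x + s *: t).
Proof.
move=> [x0 Ax] [At xt].
(* [r] dominates every ratio [|t i j| / x i j]. Where [x i j = 0], division by zero gives 0, so the
   term is harmless. *)
pose r := \sum_i \sum_j `|t i j| / x i j.
have r0 : 0 <= r by do 2!(apply: sumr_ge0 => ? _); rewrite divr_ge0.
have r1 : 0 < 1 + r by rewrite ltr_pwDl.
exists (1 + r)^-1; first by rewrite invr_gt0.
move=> s sle; split; last by rewrite linearD linearZ /= At scaler0 addr0.
move=> i j; rewrite !mxE; have [xz|xn] := eqVneq (x i j) 0.
  by rewrite xt// mulr0 addr0.
have xp : 0 < x i j by rewrite lt_def xn x0.
suff : `|s * t i j| <= x i j by rewrite ler_norml => /andP[]; lra.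
rewrite normrM; apply: (@le_trans _ _ ((1 + r)^-1 * `|t i j|)); first exact: ler_wpM2r.
rewrite mulrC ler_pdivrMr// -ler_pdivrMl// mulrC.
suff : `|t i j| / x i j <= r by lra.
rewrite /r (bigD1 i)//= (bigD1 j)//= -addrA lerDl addr_ge0//.
  by apply: sumr_ge0 => ? _; rewrite divr_ge0.
by do 2!(apply: sumr_ge0 => ? _); rewrite divr_ge0.
Qed.

(** This is the objective of a half-step: [f] is linear in the updated block, with gradient [B], and
    [c] is the other block. *)
Definition prox_obj {R : realType} {n m : nat} (rho : R) (B c x : 'M[R]_(n, m)) : R :=
  frob B x + rho / 2 * frob_sq (x - c).

Lemma prox_objD {R : realType} {n m : nat} (rho : R) (B c x d : 'M[R]_(n, m)) :
  prox_obj rho B c (x + d) =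
  prox_obj rho B c x + frob (B + rho *: (x - c)) d + rho / 2 * frob_sq d.
Proof.
rewrite /prox_obj /frob_sq addrAC; move: (x - c) => u.
rewrite [frob (B + _) d]frobC [B + rho *: u]addrC frob_linear !frobD.
rewrite [frob (u + d) u]frobC [frob (u + d) d]frobC !frobD (frobC d B) (frobC d u); lra.
Qed.

Definition is_prox {R : realType} {n m : nat} (C : 'M[R]_(n, m) -> Prop) (rho : R)
  (B c x : 'M[R]_(n, m)) : Prop :=
  C x /\ forall y, C y -> prox_obj rho B c x <= prox_obj rho B c y.

Lemma prox_dir_ge0 {R : realType} {n m : nat} (C : 'M[R]_(n, m) -> Prop) (rho : R)
    (B c x d : 'M[R]_(n, m)) s0 : is_prox C rho B c x -> 0 < s0 ->
  (forall s, 0 < s -> s <= s0 -> C (x + s *: d)) ->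
  0 <= frob (B + rho *: (x - c)) d.
Proof.
move=> [_ xmin] s00 Cd; apply: (@segment_min_ge0 _ _ (rho / 2 * frob_sq d) s0) => // s sp sle.
have := xmin _ (Cd s sp sle); rewrite prox_objD frobZ.
have -> : frob_sq (s *: d) = s ^+ 2 * frob_sq d.
  by rewrite /frob_sq frobZ frobC frobZ mulrA.
lra.
Qed.

Section ProxOnSlice.
Variables (R : realType) (n m : nat) (U : lmodType R).
Variables (A : {linear 'M[R]_(n, m) -> U}) (b : U) (rho : R) (B c x : 'M[R]_(n, m)).
Hypothesis xprox : is_prox (orthant_slice A b) rho B c x.

Lemma prox_variational y : orthant_slice A b y -> 0 <= frob (B + rho *: (x - c)) (y - x).
Proof.
case: xprox => -[x0 Ax] _ [y0 Ay]; apply: (prox_dir_ge0 _ _ _ _ _ _ 1 xprox ltr01) => s s0 s1.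
split; last by rewrite linearD linearZ linearB /= Ax Ay subrr scaler0 addr0.
move=> i j; rewrite !mxE.
have -> : x i j + s * (y i j - x i j) = (1 - s) * x i j + s * y i j by ring.
by rewrite addr_ge0 ?mulr_ge0 ?subr_ge0// ltW.
Qed.

(** Strong convexity: in the exact expansion around [x] the linear term is nonnegative by the
    variational inequality, and the quadratic term remains. *)
Lemma prox_decrease y : orthant_slice A b y ->
  prox_obj rho B c x + rho / 2 * frob_sq (y - x) <= prox_obj rho B c y.
Proof.
move=> /prox_variational h; rewrite -{2}[y](subrK x) [y - x + x]addrC prox_objD; lra.
Qed.

(** Both [t] and [- t] are feasible directions, so the slope along [t] has both signs. *)
Lemma prox_face_dir t : face_dir A x t -> frob (B + rho *: (x - c)) t = 0.
Proof.
move=> xt; have [s0 s00 h] := face_dirP _ _ _ _ xprox.1 xt.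
have ge := prox_dir_ge0 _ _ _ _ _ t _ xprox s00.
have ge' := prox_dir_ge0 _ _ _ _ _ (- t) _ xprox s00.
apply/eqP; rewrite eq_le; apply/andP; split; last first.
  by apply: ge => s sp sle; apply: h; rewrite gtr0_norm.
rewrite -oppr_ge0 -mulN1r -frobZ scaleN1r; apply: ge' => s sp sle.
by rewrite scalerN -scaleNr; apply: h; rewrite normrN gtr0_norm.
Qed.

End ProxOnSlice.

(** * Limits of matrices *)

Lemma cvg_mx_coord {R : realType} {n m : nat} (A : nat -> 'M[R]_(n, m)) (L : 'M[R]_(n, m)) :
  A @ \oo --> L <-> forall i j, (fun k => A k i j) @ \oo --> L i j.
Proof.
split=> [AL i j|AL]; first exact: (continuous_cvg _ (@coord_continuous _ _ _ i j L) AL).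
apply/cvg_mx_entourageP => E entE; apply: filter_forall => i; apply: filter_forall => j.
have /cvg_entourageP/(_ _ entE) := AL i j.
by rewrite !near_map => h; near=> k; rewrite inE; near: k.
Unshelve. all: by end_near. Qed.

Lemma cvg_sum {R : realType} {I : finType} (f : nat -> I -> R) (l : I -> R) :
  (forall i, (fun k => f k i) @ \oo --> l i) ->
  (fun k => \sum_i f k i) @ \oo --> \sum_i l i.
Proof.
by move=> fl; apply: (@cvg_big _ _ _ _ _ (@add_continuous R) _ _ _ (fun i k => f k i)).
Qed.

Lemma cvg_mulmx {R : realType} {n m p : nat} (A : nat -> 'M[R]_(n, m)) (B : nat -> 'M[R]_(m, p))
    (LA : 'M[R]_(n, m)) (LB : 'M[R]_(m, p)) :
  A @ \oo --> LA -> B @ \oo --> LB -> (fun k => A k *m B k) @ \oo --> LA *m LB.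
Proof.
move=> /cvg_mx_coord cA /cvg_mx_coord cB; apply/cvg_mx_coord => i j; rewrite mxE.
have -> : (fun k => (A k *m B k) i j) = (fun k => \sum_l A k i l * B k l j).
  by apply/funext => k; rewrite mxE.
by apply: cvg_sum => l; apply: cvgM.
Qed.

Lemma cvg_frob {R : realType} {n m : nat} (A B : nat -> 'M[R]_(n, m)) (LA LB : 'M[R]_(n, m)) :
  A @ \oo --> LA -> B @ \oo --> LB -> (fun k => frob (A k) (B k)) @ \oo --> frob LA LB.
Proof.
move=> /cvg_mx_coord cA /cvg_mx_coord cB.
by apply: cvg_sum => i; apply: cvg_sum => j; apply: cvgM.
Qed.

Lemma orthant_slice_closed {R : realType} {n m p q : nat}
    (A : {linear 'M[R]_(n, m) -> 'M[R]_(p, q)}) (b : 'M[R]_(p, q))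
    (x : nat -> 'M[R]_(n, m)) (l : 'M[R]_(n, m)) :
  (forall x l, x @ \oo --> l -> (A \o x) @ \oo --> A l) ->
  (forall k, orthant_slice A b (x k)) -> x @ \oo --> l -> orthant_slice A b l.
Proof.
move=> Acont xA xl; split => [i j|].
  have c := (cvg_mx_coord x l).1 xl i j; rewrite -(cvg_lim _ c)//.
  by apply: limr_ge; [exact: cvgP c|near=> k; exact: (xA k).1].
apply: (@cvg_unique _ (@norm_hausdorff R 'M[R]_(p, q)) _ _ _ _ (Acont _ _ xl)).
have -> : A \o x = fun=> b by apply/funext => k; exact: (xA k).2.
exact: cvg_cst.
Unshelve. all: by end_near. Qed.

(** * The alternating iteration: descent and bounds *)

Section Iteration.
Variables (R : realType) (n m : nat) (mu : 'cV[R]_n) (nu : 'cV[R]_m).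
Variables (DX : 'M[R]_n) (DY : 'M[R]_m) (rho : R) (pi w : nat -> 'M[R]_(n, m)).
Hypotheses (hmu : prob_vec mu) (hnu : prob_vec nu) (hrho : 0 < rho).
Hypothesis hpi : forall k, C1 mu (pi k.+1) /\
  forall p, C1 mu p ->
    gw_f DX DY (pi k.+1) (w k) + rho / 2 * frob_sq (pi k.+1 - w k)
    <= gw_f DX DY p (w k) + rho / 2 * frob_sq (p - w k).
Hypothesis hw : forall k, C2 nu (w k.+1) /\
  forall q, C2 nu q ->
    gw_f DX DY (pi k.+1) (w k.+1) + rho / 2 * frob_sq (w k.+1 - pi k.+1)
    <= gw_f DX DY (pi k.+1) q + rho / 2 * frob_sq (q - pi k.+1).

Let V := ('M[R]_(n, m) * 'M[R]_(n, m))%type.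

Let A1 : {linear 'M[R]_(n, m) -> 'cV[R]_n} := mulmxr (const_mx 1 : 'cV[R]_m).
Let A2 : {linear 'M[R]_(n, m) -> 'cV[R]_m} := mulmxr (const_mx 1 : 'cV[R]_n) \o trmx.

Let pi_prox k : is_prox (orthant_slice A1 mu) rho (grad_pi_f DX DY 0 (w k)) (w k) (pi k.+1).
Proof.
split=> [|y hy]; first exact: (hpi k).1.
by rewrite /prox_obj -!gw_f_grad_pi; exact: (hpi k).2.
Qed.

Let w_prox k :
  is_prox (orthant_slice A2 nu) rho (grad_w_f DX DY (pi k.+1) 0) (pi k.+1) (w k.+1).
Proof.
split=> [|y hy]; first exact: (hw k).1.
by rewrite /prox_obj -!gw_f_grad_w; exact: (hw k).2.
Qed.

Let pi_ge0 k i j : 0 <= pi k.+1 i j.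
Proof. exact: (hpi k).1.1. Qed.

Let w_ge0 k i j : 0 <= w k.+1 i j.
Proof. exact: (hw k).1.1. Qed.

Let pi_le1 k i j : pi k.+1 i j <= 1.
Proof.
have [[p0 pmu] _] := hpi k.
apply: (@le_trans _ _ (mu i 0)).
  rewrite -pmu mxE (bigD1 j)//= mxE mulr1 lerDl sumr_ge0// => l _.
  by rewrite mxE mulr1.
by rewrite -hmu.2 (bigD1 i)//= lerDl sumr_ge0// => l _; exact: hmu.1.
Qed.

Let w_le1 k i j : w k.+1 i j <= 1.
Proof.
have [[w0 wnu] _] := hw k.
apply: (@le_trans _ _ (nu j 0)).
  rewrite -wnu mxE (bigD1 i)//= !mxE mulr1 lerDl sumr_ge0// => l _.
  by rewrite !mxE mulr1.
by rewrite -hnu.2 (bigD1 j)//= lerDl sumr_ge0// => l _; exact: hnu.1.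
Qed.

(* On [C1] x [C2], [F_rho x = a x x / 2]. *)
Let a (x y : V) : R :=
  gw_f DX DY x.1 y.2 + gw_f DX DY y.1 x.2 + rho * frob (x.1 - x.2) (y.1 - y.2).

Let aC x y : a x y = a y x.
Proof. by rewrite /a frobC [X in X + _ = _]addrC. Qed.

Let alin x c y z : a x (c *: y + z) = c * a x y + a x z.
Proof.
rewrite /a; have -> : (c *: y + z).1 = c *: y.1 + z.1 by [].
have -> : (c *: y + z).2 = c *: y.2 + z.2 by [].
rewrite !(gw_f_grad_pi _ _ _ x.2 0) !(gw_f_grad_w _ _ x.1 _ 0).
by rewrite opprD addrACA -scalerBr !frob_linear; ring.
Qed.

(** The shift by one skips the initial point, which may lie outside [C1] x [C2]. *)
Let z k : V := (pi k.+1, w k.+1).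
Let F k : R := a (z k) (z k) / 2.
Let delta k : R := Num.sqrt (frob_sq (w k.+1 - w k)).

Let F_E k : F k = gw_f DX DY (pi k.+1) (w k.+1) + rho / 2 * frob_sq (pi k.+1 - w k.+1).
Proof. by rewrite /F /a /= /frob_sq; lra. Qed.

Let frob_sqC (x y : 'M[R]_(n, m)) : frob_sq (x - y) = frob_sq (y - x).
Proof. by rewrite -opprB /frob_sq -scaleN1r frobZ frobC frobZ; ring. Qed.

(** The two half-steps, each compared with the preceding iterate of its own block, telescope through
    the intermediate point [(pi k.+2, w k.+1)]. *)
Let F_decrease k : frob_sq (pi k.+2 - pi k.+1) + frob_sq (w k.+2 - w k.+1)
  <= 2 / rho * (F k - F k.+1).
Proof.
have := prox_decrease _ _ _ _ _ _ _ _ _ _ (pi_prox k.+1) (pi k.+1) (hpi k).1.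
have := prox_decrease _ _ _ _ _ _ _ _ _ _ (w_prox k.+1) (w k.+1) (hw k).1.
rewrite /prox_obj -!gw_f_grad_pi -!gw_f_grad_w.
rewrite (frob_sqC (w k.+1)) (frob_sqC (pi k.+1) (pi k.+2)).
rewrite (frob_sqC (w k.+2) (pi _)) (frob_sqC (w k.+1) (pi _)) => hw1 hp1.
rewrite !F_E mulrAC ler_pdivlMr//; lra.
Qed.

Let F_noninc k : F k.+1 <= F k.
Proof.
have := F_decrease k; have := frob_sq_ge0 (w k.+2 - w k.+1).
have := frob_sq_ge0 (pi k.+2 - pi k.+1) => h1 h2 h3.
have : 0 <= 2 / rho * (F k - F k.+1) by lra.
by rewrite pmulr_rge0 ?divr_gt0// subr_ge0.
Qed.

Let M : R := l1_norm DX * l1_norm DY.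
(** Only the first block is measured, since the gradient error on face directions lies in the [pi]
    block. *)
Let N (t : V) : R := (M + rho) * l1_norm t.1.

Let M_ge0 : 0 <= M.
Proof. by rewrite mulr_ge0 ?l1_norm_ge0. Qed.

Let F_cvgn : cvgn F.
Proof.
apply: nonincreasing_is_cvgn; first exact/nonincreasing_seqP.
exists (- (M * (n * m)%:R)) => _ [k _ <-]; rewrite F_E.
have : `|gw_f DX DY (pi k.+1) (w k.+1)| <= 1 * (M * l1_norm (pi k.+1)).
  by apply: gw_f_le => // i j; rewrite ger0_norm.
have /(ler_wpM2l M_ge0) : l1_norm (pi k.+1) <= (n * m)%:R.
  by apply: l1_norm_le => i j; rewrite ger0_norm.
have : 0 <= rho / 2 * frob_sq (pi k.+1 - w k.+1).
  by rewrite mulr_ge0 ?frob_sq_ge0// divr_ge0// ltW.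
rewrite ler_norml mul1r => h1 h2 /andP[h3 _]; lra.
Qed.

Let F_ge k : limn F <= F k.
Proof. by apply: nonincreasing_cvgn_ge => //; exact/nonincreasing_seqP. Qed.

Let delta_sqr k : delta k ^+ 2 = frob_sq (w k.+1 - w k).
Proof. by rewrite sqr_sqrtr// frob_sq_ge0. Qed.

Let delta_cvg0 : delta @ \oo --> (0 : R).
Proof.
(* The decrease controls [delta k.+1]; [delta 0] involves the initial [w 0]. *)
rewrite -cvg_shiftS.
apply: (@squeeze_cvgr _ _ _ _ (fun=> 0) (fun k => Num.sqrt (2 / rho * (F k - F k.+1)))).
- near=> k; rewrite sqrtr_ge0 ler_wsqrtr//.
  by have := F_decrease k; have := frob_sq_ge0 (pi k.+2 - pi k.+1); lra.
- exact: cvg_cst.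
rewrite -[X in _ --> X]sqrtr0; apply: continuous_cvg; first exact: sqrt_continuous.
rewrite -[X in _ --> X](mulr0 (2 / rho)); apply: cvgMr.
rewrite -(subrr (limn F)); apply: cvgB; first exact: F_cvgn.
have : F @ \oo --> limn F by exact: F_cvgn.
by rewrite -cvg_shiftS.
Unshelve. all: by end_near. Qed.

(** * Faces of the iterates and the gap to the limit value *)

Let zeros (x : 'M[R]_(n, m)) : {set 'I_n * 'I_m} := [set ij | x ij.1 ij.2 == 0].
Let face k := (zeros (pi k.+1), zeros (w k.+1)).

(* Only the [pi] block of the gradient of [F_rho] at [z k] survives on face directions, since
   [w k.+1] is optimal given [pi k.+1]. *)
Let grad_small k t : face_dir A1 (pi k.+1) t.1 -> face_dir A2 (w k.+1) t.2 ->
  `|a (z k) t| <= delta k * N t.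
Proof.
move=> t1 t2.
have := prox_face_dir _ _ _ _ _ _ _ _ _ _ (pi_prox k) _ t1.
rewrite frobC addrC frob_linear ![frob t.1 _]frobC -(gw_f_grad_pi _ _ t.1) => pi0.
have := prox_face_dir _ _ _ _ _ _ _ _ _ _ (w_prox k) _ t2.
rewrite frobC addrC frob_linear ![frob t.2 _]frobC -(gw_f_grad_w _ _ _ t.2) => w0.
(* Subtracting both stationarity identities leaves the mismatch of the [pi] half-step, which was
   taken at [w k] instead of [w k.+1]. *)
have -> : a (z k) t = gw_f DX DY t.1 (w k.+1 - w k) - rho * frob (w k.+1 - w k) t.1.
  have -> : gw_f DX DY t.1 (w k.+1 - w k) = gw_f DX DY t.1 (w k.+1) - gw_f DX DY t.1 (w k).
    by rewrite !(gw_f_grad_w _ _ t.1 _ 0) frobB.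
  move: pi0 w0; rewrite /a /= !(frobC _ t.1) !(frobC _ t.2) !(frobC _ (t.1 - t.2)) !frobB.
  rewrite ![frob (t.1 - t.2) _]frobC !frobB ![frob _ t.1]frobC ![frob _ t.2]frobC; lra.
have small i j : `|(w k.+1 - w k) i j| <= delta k.
  by rewrite -sqrtr_sqr ler_wsqrtr// sqr_entry_le_frob_sq.
rewrite (le_trans (ler_normB _ _))// /N mulrDl mulrDr lerD//.
  by apply: gw_f_le => //; exact: sqrtr_ge0.
rewrite normrM (gtr0_norm hrho) mulrCA (ler_wpM2l (ltW hrho))// frobC.
exact: frob_le_l1.
Qed.

Let Fs := limn F.

Let F_gap : exists2 C, 0 <= C &
  exists K, forall k, (K <= k)%N -> F k - Fs <= C * delta k ^+ 2.
Proof.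
(* [T J] consists of the directions that preserve both marginals and vanish on the zero pattern [J];
   patterns form a finite type. *)
have /choice[T hT] : forall J : {set 'I_n * 'I_m} * {set 'I_n * 'I_m},
    exists T : {vspace V}, forall t, t \in T <->
      [/\ A1 t.1 = 0, A2 t.2 = 0, forall ij, ij \in J.1 -> t.1 ij.1 ij.2 = 0
        & forall ij, ij \in J.2 -> t.2 ij.1 ij.2 = 0].
  move=> J; apply: subspace_vspace.
    by split; rewrite ?linear0// => ij _; rewrite mxE.
  move=> c u v [u1 u2 u3 u4] [v1 v2 v3 v4]; split.
  - by rewrite linearP u1 v1 scaler0 addr0.
  - by rewrite linearP u2 v2 scaler0 addr0.
  - by move=> ij J1; rewrite !mxE u3// v3// mulr0 addr0.
  - by move=> ij J2; rewrite !mxE u4// v4// mulr0 addr0.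
have Tdir k t : t \in T (face k) -> face_dir A1 (pi k.+1) t.1 /\ face_dir A2 (w k.+1) t.2.
  move=> /hT[t1 t2 t3 t4]; split; split=> // i j xz.
    by apply: (t3 (i, j)); rewrite inE /= xz.
  by apply: (t4 (i, j)); rewrite inE /= xz.
apply: (quadratic_gap_le a aC alin z face T N delta ((M + rho) * (n * m)%:R) Fs) => //.
- by move=> k; exact: sqrtr_ge0.
- move=> k l kl; apply/hT.
  have zerosB (x y : 'M[R]_(n, m)) : zeros x = zeros y ->
      forall ij, ij \in zeros x -> (x - y) ij.1 ij.2 = 0.
    move=> xy ij /[dup]; rewrite {2}xy !inE !mxE => /eqP-> /eqP->.
    by rewrite subrr.
  case: kl => kl1 kl2; split; try exact: zerosB.
    by rewrite linearB (pi_prox k).1.2 (pi_prox l).1.2 subrr.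
  by rewrite linearB (w_prox k).1.2 (w_prox l).1.2 subrr.
- by move=> k t /Tdir[]; exact: grad_small.
- move=> k l; apply: ler_wpM2l; first by rewrite addr_ge0// ltW.
  apply: l1_norm_le => i j; rewrite /= !mxE ler_norml.
  by have := pi_ge0 k i j; have := pi_ge0 l i j; have := pi_le1 k i j;
    have := pi_le1 l i j; lra.
Qed.

(** * Convergence of the iterates and criticality of the limit *)

Let z_entries_cvgn (x : nat -> R) : (forall k, 0 <= x k) ->
  (forall k, (x k.+1 - x k) ^+ 2 <= 2 / rho * (F k - F k.+1)) -> cvgn x.
Proof.
move=> x0 xF; have [C C0 [K FC]] := F_gap.
apply: (descent_cvgn F x Fs (2 / rho) (C * (2 / rho)) K) => //; first by rewrite divr_gt0.
  by rewrite mulr_ge0// divr_ge0// ltW.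
(* The gap is taken at [k.+1], since [delta k.+1] is the step bounded by [F k - F k.+1]. *)
move=> k Kk; apply: le_trans (FC _ (leqW Kk)) _; rewrite -mulrA ler_wpM2l// delta_sqr.
by have := F_decrease k; have := frob_sq_ge0 (pi k.+2 - pi k.+1); lra.
Qed.

Let pi_cvg : exists L : 'M[R]_(n, m), pi @ \oo --> L.
Proof.
have entry_cvgn i j : cvgn (fun k => pi k.+1 i j).
  apply: z_entries_cvgn => // k.
  have := sqr_entry_le_frob_sq (pi k.+2 - pi k.+1) i j; rewrite !mxE.
  by have := F_decrease k; have := frob_sq_ge0 (w k.+2 - w k.+1); lra.
exists (\matrix_(i, j) limn (fun k => pi k.+1 i j)); rewrite -cvg_shiftS.
by apply/cvg_mx_coord => i j; rewrite mxE; exact: entry_cvgn.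
Qed.

Let w_cvg : exists L : 'M[R]_(n, m), w @ \oo --> L.
Proof.
have entry_cvgn i j : cvgn (fun k => w k.+1 i j).
  apply: z_entries_cvgn => // k.
  have := sqr_entry_le_frob_sq (w k.+2 - w k.+1) i j; rewrite !mxE.
  by have := F_decrease k; have := frob_sq_ge0 (pi k.+2 - pi k.+1); lra.
exists (\matrix_(i, j) limn (fun k => w k.+1 i j)); rewrite -cvg_shiftS.
by apply/cvg_mx_coord => i j; rewrite mxE; exact: entry_cvgn.
Qed.

Lemma iteration_cvg_critical : exists pibar wbar : 'M[R]_(n, m),
  (fun k => (pi k, w k)) @ \oo --> (pibar, wbar) /\
  critical_point DX DY mu nu rho pibar wbar.
Proof.
have [p pip] := pi_cvg; have [q wq] := w_cvg; exists p, q; split; first exact: (cvg_pair pip wq).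
have pip1 : (fun k => pi k.+1) @ \oo --> p.
  by move: pip; rewrite -cvg_shiftS.
have wq1 : (fun k => w k.+1) @ \oo --> q.
  by move: wq; rewrite -cvg_shiftS.
have tr_cvg (x : nat -> 'M[R]_(n, m)) (l : 'M[R]_(n, m)) :
    x @ \oo --> l -> (fun k => (x k)^T) @ \oo --> l^T.
  move=> /cvg_mx_coord xl; apply/cvg_mx_coord => i j; rewrite mxE.
  by have -> : (fun k => (x k)^T i j) = (fun k => x k j i); [apply/funext => k; rewrite mxE|].
have pC : C1 mu p.
  apply: (orthant_slice_closed A1 mu _ _ _ (fun k => (hpi k).1) pip1) => x l xl.
  by apply: cvg_mulmx => //; exact: cvg_cst.
have qC : C2 nu q.
  apply: (orthant_slice_closed A2 nu _ _ _ (fun k => (hw k).1) wq1) => x l xl.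
  by apply: cvg_mulmx; [exact: tr_cvg|exact: cvg_cst].
have frobNl (x y : 'M[R]_(n, m)) : frob (- x) y = - frob x y.
  by rewrite frobC -scaleN1r frobZ mulN1r frobC.
split; split=> // y yC; rewrite frobNl oppr_le0.
  (* The half-step mixes [pi k.+1] with [w k], but [w k] and [w k.+1] share the limit [q], so the
     variational inequality passes to the limit. *)
  have c : (fun k => frob (grad_pi_f DX DY 0 (w k) + rho *: (pi k.+1 - w k)) (y - pi k.+1))
      @ \oo --> frob (grad_pi_f DX DY p q + rho *: (p - q)) (y - p).
    apply: cvg_frob; last by apply: cvgB => //; exact: cvg_cst.
    apply: cvgD; last by apply: cvgZr; exact: cvgB.
    apply: cvgN; apply: cvg_mulmx; last exact: cvg_cst.
    by apply: cvg_mulmx => //; exact: cvg_cst.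
  rewrite -(cvg_lim _ c)//; apply: limr_ge; first exact: cvgP c.
  by near=> k; exact: (prox_variational _ _ _ _ _ _ _ _ _ _ (pi_prox k)).
have c : (fun k => frob (grad_w_f DX DY (pi k.+1) 0 + rho *: (w k.+1 - pi k.+1)) (y - w k.+1))
    @ \oo --> frob (grad_w_f DX DY p q + rho *: (q - p)) (y - q).
  apply: cvg_frob; last by apply: cvgB => //; exact: cvg_cst.
  apply: cvgD; last by apply: cvgZr; exact: cvgB.
  apply: cvgN; apply: cvg_mulmx; last exact: cvg_cst.
  by apply: cvg_mulmx => //; exact: cvg_cst.
rewrite -(cvg_lim _ c)//; apply: limr_ge; first exact: cvgP c.
by near=> k; exact: (prox_variational _ _ _ _ _ _ _ _ _ _ (w_prox k)).
Unshelve. all: by end_near. Qed.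
End Iteration.

Theorem theorem2 (R : realType) (n m : nat) (hn : (0 < n)%N) (hm : (0 < m)%N)
  (mu : 'cV[R]_n) (nu : 'cV[R]_m) (hmu : prob_vec mu) (hnu : prob_vec nu)
  (DX : 'M[R]_n) (DY : 'M[R]_m) (hDX : DX^T = DX) (hDY : DY^T = DY)
  (rho : R) (hrho : 0 < rho)
  (pi w : nat -> 'M[R]_(n, m))
  (hpi : forall k, C1 mu (pi k.+1) /\
     forall p, C1 mu p ->
       gw_f DX DY (pi k.+1) (w k) + rho / 2 * frob_sq (pi k.+1 - w k)
       <= gw_f DX DY p (w k) + rho / 2 * frob_sq (p - w k))
  (hw : forall k, C2 nu (w k.+1) /\
     forall q, C2 nu q ->
       gw_f DX DY (pi k.+1) (w k.+1) + rho / 2 * frob_sq (w k.+1 - pi k.+1)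
       <= gw_f DX DY (pi k.+1) q + rho / 2 * frob_sq (q - pi k.+1)) :
  exists (pibar wbar : 'M[R]_(n, m)),
    (fun k => (pi k, w k)) @ \oo --> (pibar, wbar) /\
    critical_point DX DY mu nu rho pibar wbar.
Proof.
exact: (iteration_cvg_critical _ _ _ _ _ _ _ _ _ _ hmu hnu hrho hpi hw).
Qed.
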